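(* Let $n\ge 1$, let $\{b_{ij}:1\le j\le i\le n\}$ be given real scalars, and let $\{g_{ij}:1\le j\le i\le n\}$ be i.i.d. $N(0,1)$ random variables. Let $X$ be the $n\times n$ symmetric random matrix with $X_{ij}=X_{ji}=g_{ij}b_{ij}$ for $i\ge j$. Set $b_{ij}:=b_{ji}$ for $i<j$ and define $$\sigma:=\max_i\sqrt{\sum_j b_{ij}^2},\qquad \sigma_*:=\max_{ij}|b_{ij}|.$$ Then for any $0<\varepsilon\le 1/2$, $$\mathbb{E}\|X\|\le (1+\varepsilon)\Big\{2\sigma+\frac{6}{\sqrt{\log(1+\varepsilon)}}\,\sigma_*\sqrt{\log n}\Big\}.$$
   Context: $\|\cdot\|$ denotes the spectral (operator) norm and $\log$ the natural logarithm. *)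

(* Defs.v *)
From HB Require Import structures.
From mathcomp Require Import all_boot all_order all_algebra.
From mathcomp Require Import all_classical all_reals all_analysis.
Set Implicit Arguments. Unset Strict Implicit. Unset Printing Implicit Defensive.
Import Order.TTheory GRing.Theory Num.Theory.
Local Open Scope classical_set_scope.
Local Open Scope ring_scope.

Definition vnorm2 {R : realType} {n : nat} (v : 'cV[R]_n) : R :=
  Num.sqrt (\sum_(i < n) v i 0 ^+ 2).

Definition opnorm {R : realType} {n : nat} (A : 'M[R]_n) : R :=
  sup [set vnorm2 (A *m v) | v in [set v : 'cV[R]_n | vnorm2 v = 1]].

(* symmetric extension: b_{ij} := b_{ji} for i < j; only the entries with j <= i
   (lower triangle incl. diagonal) of b are used *)
Definition symext {R : Type} {n : nat} (b : 'I_n -> 'I_n -> R) (i j : 'I_n) : R :=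
  if (j <= i)%N then b i j else b j i.

Definition randmx {T : Type} {R : realType} {n : nat}
  (b : 'I_n -> 'I_n -> R) (g : 'I_n -> 'I_n -> T -> R) (w : T) : 'M[R]_n :=
  \matrix_(i, j) (symext b i j * symext (fun k l => g k l w) i j).

Definition sigma_row {R : realType} {n : nat} (b : 'I_n -> 'I_n -> R) : R :=
  \big[Num.max/0]_(i < n) Num.sqrt (\sum_(j < n) symext b i j ^+ 2).

Definition sigma_star {R : realType} {n : nat} (b : 'I_n -> 'I_n -> R) : R :=
  \big[Num.max/0]_(i < n) \big[Num.max/0]_(j < n) `|symext b i j|.

Definition iid_std_gaussian {d} {T : measurableType d} {R : realType}
  (P : probability T R) (n : nat) (g : 'I_n -> 'I_n -> T -> R) : Prop :=
  [/\ (forall i j : 'I_n, (j <= i)%N -> measurable_fun setT (g i j)),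
      (forall i j : 'I_n, (j <= i)%N -> forall A : set R, measurable A ->
          P (g i j @^-1` A) = normal_prob 0 1 A) &
      (forall A : 'I_n -> 'I_n -> set R, (forall i j, measurable (A i j)) ->
          P [set w | forall i j : 'I_n, (j <= i)%N -> A i j (g i j w)] =
          (\prod_(i < n) \prod_(j < n | (j <= i)%N) P (g i j @^-1` A i j))%E)].

(* Main.v *)
(* Let sigma_* bound the entries |b_ij| and sigma the Euclidean norms of the rows.
   The theorem follows from the moment bound
   E (X^(2p))_uu <= (2c)^(2p) for every u, whenever c^2 >= sigma^2 + 4 p sigma_*^2,
   by taking for p the integer part of log n / log (1 + eps), so that
   n^(1/2p) <= 1 + eps.  Passing from E tr X^(2p) to E ||X|| only takes a tangent line
   of x^(2p), which spares the proof that the operator norm is measurable.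

   For the moment bound, expand X^(2p) along walks and the Gaussian products in
   Hermite polynomials: by x He_k = He_(k+1) + k He_(k-1), a step of the walk along
   an edge either opens a copy of this edge or closes one of its open copies
   (with weight b_vw^2), and only walks that close everything contribute to the
   expectation.  Let delta_x be the number of open half edges at the vertex x, plus
   one if the walker is at x.  Weigh a state by the product over the open edges of
   b_vw^2 and over x of (delta_x - 1) (delta_x - 3) ...  The weight lost when an edge
   is closed at v pays exactly for the choice of that edge, and an opening step costs
   sum_w b_vw^2 (delta_w + 1) <= sigma^2 + sigma_*^2 (2 E + 1), where E is the
   number of open edges.  So each opening contributes a factor at most c^2, and the
   choice between opening and closing contributes 2^(2p). *)
Require Import Defs.
From mathcomp Require Import all_boot all_order all_algebra.
From mathcomp Require Import all_classical all_reals all_analysis.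
From mathcomp Require Import measurable_realfun.
From mathcomp Require Import ring lra zify.
Import Order.TTheory GRing.Theory Num.Theory.
Import numFieldNormedType.Exports.
Local Open Scope classical_set_scope.
Local Open Scope ring_scope.
Set Implicit Arguments. Unset Strict Implicit. Unset Printing Implicit Defensive.

(** * Families modified at one index *)

Lemma big_dfwith (V : Type) (idx : V) (op : Monoid.com_law idx) (I : finType)
    (T : I -> Type) (F : forall i, T i -> V) (f : forall i, T i) (i : I) (x : T i) :
  \big[op/idx]_j F j (dfwith f i x j) =
    op (F i x) (\big[op/idx]_(j | j != i) F j (f j)).
Proof.
rewrite (bigD1 i) //= dfwithin; congr (op _ _).
by apply: eq_bigr => j ji; rewrite dfwithout // eq_sym.
Qed.

Lemma dfwith_ind (I : finType) (V : Type) (A B : I -> V -> Prop) (Q : (I -> V) -> Prop) :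
  (forall i x, A i x -> B i x) ->
  (forall f, (forall i, A i (f i)) -> Q f) ->
  (forall f i, (forall j, B j (f j)) -> (forall x, A i x -> Q (dfwith f i x)) -> Q f) ->
  forall f, (forall i, B i (f i)) -> Q f.
Proof.
move=> AB QA QB f Bf.
have : forall i, i \notin enum I -> A i (f i) by move=> i; rewrite mem_enum.
elim: (enum I) f Bf => [|i s IHs] f Bf Af; first by apply: QA => i; exact: Af.
apply: (QB f i) => // x Ax; apply: IHs => j.
  by case: dfwithP => //; exact: AB.
by case: dfwithP => // k ik ks; apply: Af; rewrite inE negb_or eq_sym ik.
Qed.

Section multi_index.
Variable I : finType.
Implicit Types (i : I) (m : I -> nat).

Definition raise i m : I -> nat := dfwith m i (m i).+1.
Definition lower i m : I -> nat := dfwith m i (m i).-1.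

Lemma raiseE i m : raise i m i = (m i).+1.
Proof. exact: dfwithin. Qed.

Lemma raiseK i m : lower i (raise i m) = m.
Proof.
apply/funext => j; rewrite /lower raiseE.
by case: dfwithP => // k ik; rewrite /raise dfwithout.
Qed.

Lemma lowerK i m : (0 < m i)%N -> raise i (lower i m) = m.
Proof.
move=> mi; apply/funext => j; rewrite /raise /lower dfwithin prednK //.
by case: dfwithP => // k ik; rewrite dfwithout.
Qed.

Lemma sum_raise i m (c : I -> nat) :
  (\sum_j raise i m j * c j = c i + \sum_j m j * c j)%N.
Proof.
by rewrite (big_dfwith _ (fun j k => k * c j)%N) /= mulSn -addnA [in RHS](bigD1 i).
Qed.

Lemma prod_expr_raise (R : comPzSemiRingType) (x : I -> R) i m :
  \prod_j x j ^+ raise i m j = x i * \prod_j x j ^+ m j.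
Proof.
by rewrite (big_dfwith _ (fun j k => x j ^+ k)) /= exprS -mulrA [in RHS](bigD1 i).
Qed.

End multi_index.

(** * Weighted closed walks *)

Fixpoint double_fact (k : nat) : nat :=
  if k is (k'.+1).+1 then (k * double_fact k')%N else 1%N.

Lemma double_factS (k : nat) : double_fact k.+1 = (k.+1 * double_fact k.-1)%N.
Proof. by case: k. Qed.

Lemma prod_double_fact_shift (I : finType) (d d' : I -> nat) (i : I) :
  (forall j, d' j = d j + (j == i).*2)%N ->
  (\prod_j double_fact (d' j).-1 = (d i).+1 * \prod_j double_fact (d j).-1)%N.
Proof.
move=> d'E; rewrite (bigD1 i) //= [in RHS](bigD1 i) //= mulnA; congr muln.
  by rewrite d'E eqxx addn2; exact: double_factS.
by apply: eq_bigr => j /negbTE ji; rewrite d'E ji addn0.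
Qed.

Lemma sum_eq_op (I : finType) (i : I) : (\sum_j (j == i) = 1)%N.
Proof. by rewrite (bigD1 i) //= eqxx big1 // => j /negbTE ->. Qed.

Definition uedge (n : nat) : finType := {e : 'I_n * 'I_n | (e.2 <= e.1)%N}.

Section edges.
Variable n : nat.
Implicit Types (u v w x : 'I_n) (e : uedge n) (m : uedge n -> nat).

Fact edge_subproof v w : let e := if (w <= v)%N then (v, w) else (w, v) in (e.2 <= e.1)%N.
Proof. by case: (leqP w v) => //= /ltnW. Qed.

Definition edge v w : uedge n :=
  Sub (if (w <= v)%N then (v, w) else (w, v)) (edge_subproof v w).

Lemma edgeC v w : edge v w = edge w v.
Proof.
by apply/val_inj; rewrite /=; case: ltngtP => // vw; rewrite (val_inj vw).
Qed.

Lemma edge_val e : edge (val e).1 (val e).2 = e.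
Proof. by apply/val_inj; rewrite /= (valP e) -surjective_pairing. Qed.

Lemma edge_inj v : injective (edge v).
Proof.
move=> w w' /(congr1 val) /=.
by do 2 case: leqP => ?; case; do ?move=> ->.
Qed.

Definition edge_fun (U : Type) (f : 'I_n -> 'I_n -> U) e : U := f (val e).1 (val e).2.

Lemma symext_edge (U : Type) (f : 'I_n -> 'I_n -> U) v w :
  symext f v w = edge_fun f (edge v w).
Proof. by rewrite /symext /edge_fun /=; case: ifP. Qed.

Definition incidence e x : nat := ((x == (val e).1) + (x == (val e).2))%N.

Lemma incidence_edge v w x : incidence (edge v w) x = ((x == v) + (x == w))%N.
Proof. by rewrite /incidence /=; case: ifP => _ //=; rewrite addnC. Qed.

Lemma sum_incidence e : (\sum_x incidence e x = 2)%N.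
Proof. by rewrite big_split /= !sum_eq_op. Qed.

Definition nedges m : nat := \sum_e m e.
Definition degree m x : nat := (\sum_e m e * incidence e x)%N.

Lemma nedges0 : nedges (fun=> 0%N) = 0%N.
Proof. by rewrite /nedges big1. Qed.

Lemma nedges_raise e m : nedges (raise e m) = (nedges m).+1.
Proof. by rewrite /nedges (big_dfwith _ (fun=> id)) [in RHS](bigD1 e). Qed.

Lemma degree_raise e m x : degree (raise e m) x = (incidence e x + degree m x)%N.
Proof. exact: sum_raise. Qed.

Lemma sum_degree m : (\sum_x degree m x = (nedges m).*2)%N.
Proof.
rewrite exchange_big /= -muln2 big_distrl /=; apply: eq_bigr => e _.
by rewrite -big_distrr /= sum_incidence.
Qed.

Lemma sum_edge_le_degree m v : (\sum_w m (edge v w) <= degree m v)%N.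
Proof.
rewrite -(big_imset m) /=; last by move=> ? ? _ _; apply: edge_inj.
rewrite /degree [leqRHS](bigID (mem [set edge v w | w in 'I_n]%SET)) /=.
apply: leq_trans (leq_addr _ _); apply: leq_sum => e /imsetP[w _ ->].
by rewrite incidence_edge eqxx leq_pmulr.
Qed.

(* The walker at [v] counts as one more half edge, so that a step from [v] to [w]
   changes only one of these numbers, by two: opening an edge adds two half edges
   at [w], closing one removes two at [v]. *)
Definition half_edges m v x : nat := (degree m x + (x == v))%N.

Lemma half_edges_raise m v w x :
  half_edges (raise (edge v w) m) w x = (half_edges m v x + (x == w).*2)%N.
Proof. rewrite /half_edges degree_raise incidence_edge; lia. Qed.

Lemma sum_half_edges m v : (\sum_w half_edges m v w = (nedges m).*2.+1)%N.
Proof. by rewrite big_split /= sum_degree sum_eq_op addn1. Qed.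

End edges.

Section walk_moment.
Variables (R : realFieldType) (n : nat) (B : uedge n -> R).
Implicit Types (u v w : 'I_n) (m : uedge n -> nat).

(* With [B = b ^ 2], this is the expectation of the [(v, u)] entry of [X ^ t] times
   the product over the edges [e] of [b_e ^ m_e He_(m_e) (g_e)]. *)
Fixpoint walk_moment u t m v : R :=
  if t is t'.+1 then
    \sum_w (walk_moment u t' (raise (edge v w) m) w +
      (m (edge v w))%:R * B (edge v w) * walk_moment u t' (lower (edge v w) m) w)
  else ((v == u) && [forall e, m e == 0%N])%:R.

Definition walk_weight m v : R :=
  (\prod_e B e ^+ m e) * (\prod_x double_fact (half_edges m v x).-1)%:R.

Lemma walk_weight_raise m v w : walk_weight (raise (edge v w) m) w =
  B (edge v w) * (half_edges m v w).+1%:R * walk_weight m v.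
Proof.
rewrite /walk_weight prod_expr_raise (prod_double_fact_shift (half_edges_raise m v w)).
by rewrite natrM mulrACA.
Qed.

Lemma walk_weight_lower m v w : (0 < m (edge v w))%N ->
  walk_weight m v = B (edge v w) * (degree m v)%:R * walk_weight (lower (edge v w) m) w.
Proof.
rewrite edgeC => mvw; rewrite -{1}(lowerK mvw) walk_weight_raise.
rewrite -[in degree m v](lowerK mvw) /half_edges degree_raise incidence_edge eqxx.
by congr (_ * _%:R * _); lia.
Qed.

Lemma walk_weight0 v : walk_weight (fun=> 0%N) v = 1.
Proof.
rewrite /walk_weight !big1 ?mulr1 // => x _.
by rewrite /half_edges /degree big1 //; case: (x == v).
Qed.

Hypothesis B_ge0 : forall e, 0 <= B e.

Lemma walk_weight_ge0 m v : 0 <= walk_weight m v.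
Proof. by rewrite mulr_ge0 // prodr_ge0 // => e _; rewrite exprn_ge0. Qed.

Lemma sum_walk_weight_raise_le (K S : R) m v :
  (forall e, B e <= K) -> \sum_w B (edge v w) <= S ->
  \sum_w walk_weight (raise (edge v w) m) w <=
    (S + K * (nedges m).*2.+1%:R) * walk_weight m v.
Proof.
move=> BK BS; under eq_bigr do rewrite walk_weight_raise.
rewrite -mulr_suml ler_wpM2r ?walk_weight_ge0 //.
under eq_bigr do rewrite -natr1 mulrDr mulr1.
rewrite big_split addrC lerD //= -(sum_half_edges m v) natr_sum mulr_sumr.
by apply: ler_sum => w _; rewrite ler_wpM2r.
Qed.

Lemma sum_walk_weight_lower_le m v :
  \sum_w (m (edge v w))%:R * B (edge v w) * walk_weight (lower (edge v w) m) w
    <= walk_weight m v.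
Proof.
have sum_le := sum_edge_le_degree m v.
have [deg0|deg_gt0] := posnP (degree m v).
  rewrite big1 ?walk_weight_ge0 // => w _.
  move: sum_le; rewrite deg0 leqn0 sum_nat_eq0 => /forallP /(_ w) /eqP ->.
  by rewrite !mul0r.
rewrite -(ler_pM2l (_ : 0 < (degree m v)%:R)) ?ltr0n // mulr_sumr.
rewrite (eq_bigr (fun w => (m (edge v w))%:R * walk_weight m v)) => [|w _].
  by rewrite -mulr_suml -natr_sum ler_wpM2r ?walk_weight_ge0 // ler_nat.
have [->|mvw] := posnP (m (edge v w)); first by rewrite !mul0r mulr0.
by rewrite (walk_weight_lower mvw); ring.
Qed.

Lemma walk_moment_le (K S c : R) (N : nat) u t m v :
  (forall e, B e <= K) -> (forall v, \sum_w B (edge v w) <= S) ->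
  0 < c -> S + K * N.*2%:R <= c ^+ 2 -> (nedges m + t <= N)%N ->
  walk_moment u t m v * c ^+ nedges m <= (2 * c) ^+ t * walk_weight m v.
Proof.
move=> BK BS c_gt0 SKc; elim: t m v => [|t IHt] m v mtN.
  rewrite mul1r /=; have [/andP[_ /forallP m0]|_] := boolP (_ && _); last first.
    by rewrite mul0r walk_weight_ge0.
  have -> : m = fun=> 0%N by apply/funext => e; apply/eqP.
  by rewrite walk_weight0 nedges0 mul1r.
set C := (2 * c) ^+ t; have C_ge0 : 0 <= C by rewrite exprn_ge0 // mulr_ge0 // ltW.
have -> : (2 * c) ^+ t.+1 * walk_weight m v =
    C * c * walk_weight m v + C * c * walk_weight m v by rewrite exprSr -/C; ring.
have open_le : (\sum_w walk_moment u t (raise (edge v w) m) w) * c ^+ nedges m <=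
    C * c * walk_weight m v.
  rewrite -(ler_pM2r c_gt0) -[leLHS]mulrA -exprSr mulr_suml.
  apply: (@le_trans _ _ (C * \sum_w walk_weight (raise (edge v w) m) w)).
    rewrite mulr_sumr; apply: ler_sum => w _.
    by rewrite -(nedges_raise (edge v w)) IHt // nedges_raise addSnnS.
  have -> : C * c * walk_weight m v * c = C * (c ^+ 2 * walk_weight m v) by ring.
  rewrite ler_wpM2l //; apply: le_trans (sum_walk_weight_raise_le m BK (BS v)) _.
  rewrite ler_wpM2r ?walk_weight_ge0 //; apply: le_trans SKc.
  rewrite lerD2l ler_wpM2l ?(le_trans (B_ge0 (edge v v))) // ler_nat; lia.
have close_le : (\sum_w (m (edge v w))%:R * B (edge v w) *
      walk_moment u t (lower (edge v w) m) w) * c ^+ nedges m <=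
    C * c * walk_weight m v.
  apply: le_trans (ler_wpM2l _ (sum_walk_weight_lower_le m v)); last first.
    by rewrite mulr_ge0 // ltW.
  rewrite mulr_suml mulr_sumr; apply: ler_sum => w _.
  have [->|mvw] := posnP (m (edge v w)); first by rewrite !mul0r mulr0.
  rewrite -{3}(lowerK mvw) nedges_raise exprSr.
  have lowerN : (nedges (lower (edge v w) m) + t <= N)%N.
    by move: mtN; rewrite -{1}(lowerK mvw) nedges_raise; lia.
  have mB_ge0 : 0 <= (m (edge v w))%:R * B (edge v w) * c.
    by rewrite !mulr_ge0 // ltW.
  by have := ler_wpM2l mB_ge0 (IHt _ w lowerN); rewrite -/C; congr (_ <= _); ring.
by rewrite /= big_split mulrDl lerD.
Qed.

Corollary closed_walk_moment_le (K S c : R) u t :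
  (forall e, B e <= K) -> (forall v, \sum_w B (edge v w) <= S) ->
  0 < c -> S + K * t.*2%:R <= c ^+ 2 ->
  walk_moment u t (fun=> 0%N) u <= (2 * c) ^+ t.
Proof.
move=> BK BS c_gt0 SKc.
have := walk_moment_le u u BK BS c_gt0 SKc (_ : nedges (fun=> 0%N) + t <= t)%N.
by rewrite nedges0 walk_weight0 !mulr1; exact.
Qed.

Lemma walk_moment2 u : walk_moment u 2 (fun=> 0%N) u = \sum_w B (edge u w).
Proof.
rewrite /=; apply: eq_bigr => w _; rewrite !mul0r addr0 (bigD1 u) //=.
rewrite [X in _ + X]big1 => [|x /negbTE xu]; last by rewrite xu mulr0 addr0.
have raise_neq0 e m : [forall f, raise e m f == 0%N] = false.
  by apply/negbTE/forallPn; exists e; rewrite raiseE.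
rewrite (edgeC w u) raise_neq0 raiseK raiseE eqxx andbF add0r addr0 mul1r.
by case: forallP => [_|[]] //; rewrite mulr1.
Qed.

End walk_moment.

(** * Operator norm and traces of powers *)

Lemma sum_CauchySchwarz (R : realDomainType) (I : finType) (x y : I -> R) :
  (\sum_i x i * y i) ^+ 2 <= (\sum_i x i ^+ 2) * (\sum_i y i ^+ 2).
Proof.
set D := \sum_i _ * _; set X := \sum_i _; set Y := \sum_i _.
have Y_ge0 : 0 <= Y by apply: sumr_ge0 => i _; exact: sqr_ge0.
have [Y0|Y_neq0] := eqVneq Y 0.
  have y0 i : y i = 0.
    apply/eqP; rewrite -sqrf_eq0; apply/eqP/(psumr_eq0P _ Y0) => // j _.
    exact: sqr_ge0.
  by rewrite /D big1 ?expr0n ?Y0 ?mulr0 // => i _; rewrite y0 mulr0.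
have Y_gt0 : 0 < Y by rewrite lt_neqAle eq_sym Y_neq0.
rewrite -subr_ge0 -(pmulr_rge0 _ Y_gt0).
have sum_sqrB s t :
    \sum_i (s * x i - t * y i) ^+ 2 = s ^+ 2 * X - 2 * s * t * D + t ^+ 2 * Y.
  rewrite /X /D /Y !mulr_sumr -sumrB -big_split /=.
  by apply: eq_bigr => i _; ring.
have -> : Y * (X * Y - D ^+ 2) = \sum_i (Y * x i - D * y i) ^+ 2.
  by rewrite sum_sqrB; ring.
by apply: sumr_ge0 => i _; exact: sqr_ge0.
Qed.

Lemma logconvex_expr_le (R : realDomainType) (a : nat -> R) (p : nat) :
  (forall k, 0 <= a k) -> a 0 = 1 -> (forall k, a k.+1 ^+ 2 <= a k * a k.+2) ->
  a 1 ^+ p <= a p.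
Proof.
move=> a_ge0 a0 a_logconvex.
have a1_le k : a 1 * a k <= a k.+1.
  elim: k => [|k IHk]; first by rewrite a0 mulr1.
  have [->|ak_neq0] := eqVneq (a k.+1) 0; first by rewrite mulr0.
  have ak_gt0 : 0 < a k.+1 by rewrite lt_neqAle eq_sym ak_neq0 a_ge0.
  rewrite -(ler_pM2r ak_gt0) -mulrA -expr2.
  apply: le_trans (ler_wpM2l (a_ge0 1) (a_logconvex k)) _.
  by rewrite mulrA [leRHS]mulrC ler_wpM2r.
elim: p => [|p IHp]; first by rewrite a0.
by rewrite exprS; apply: le_trans (a1_le p); rewrite ler_wpM2l.
Qed.

Lemma Bernoulli_ineq (R : realDomainType) (x : R) (q : nat) :
  0 <= x -> 1 + q%:R * (x - 1) <= x ^+ q.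
Proof.
move=> x_ge0; elim: q => [|q IHq]; first by rewrite mul0r addr0.
rewrite exprS; apply: le_trans (ler_wpM2l x_ge0 IHq).
rewrite -natr1 -subr_ge0.
have -> : x * (1 + q%:R * (x - 1)) - (1 + (q%:R + 1) * (x - 1)) = q%:R * (x - 1) ^+ 2.
  by ring.
by rewrite mulr_ge0 // sqr_ge0.
Qed.

Lemma le_expr_tangent (R : realFieldType) (x a : R) (q : nat) :
  0 <= x -> 0 < a -> (0 < q)%N -> x <= a + a / q%:R * (x ^+ q / a ^+ q - 1).
Proof.
move=> x_ge0 a_gt0 q_gt0; have q_gt0' : 0 < q%:R :> R by rewrite ltr0n.
have := Bernoulli_ineq q (divr_ge0 x_ge0 (ltW a_gt0)).
rewrite expr_div_n -lerBrDl => /(ler_wpM2l (divr_ge0 (ltW a_gt0) (ltW q_gt0'))).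
suff -> : a / q%:R * (q%:R * (x / a - 1)) = x - a by rewrite lerBlDl.
by field; rewrite !gt_eqF.
Qed.

Section opnorm_trace.
Variables (R : realType) (n : nat).
Implicit Types (A X : 'M[R]_n) (v w : 'cV[R]_n).

Lemma sqr_vnorm2 v : vnorm2 v ^+ 2 = \sum_i v i 0 ^+ 2.
Proof. by rewrite sqr_sqrtr // sumr_ge0 // => i _; exact: sqr_ge0. Qed.

Lemma sum_mulmx_sym X v w : X^T = X ->
  \sum_i (X *m v) i 0 * w i 0 = \sum_i v i 0 * (X *m w) i 0.
Proof.
have dotE v' w' : \sum_i v' i 0 * w' i 0 = (v'^T *m w') 0 0.
  by rewrite mxE; apply: eq_bigr => i _; rewrite mxE.
by move=> XT; rewrite !dotE trmx_mul XT mulmxA.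
Qed.

Lemma trmx_expr X p : (X ^+ p)^T = X^T ^+ p.
Proof.
elim: p => [|p IHp]; first by rewrite !expr0 trmx1.
by rewrite exprS exprSr -IHp; exact: trmx_mul.
Qed.

Lemma mxtrace_expr_double X p : X^T = X ->
  \tr (X ^+ p.*2) = \sum_i \sum_j (X ^+ p) i j ^+ 2.
Proof.
move=> XT; rewrite -addnn exprD; apply: eq_bigr => i _.
rewrite mxE; apply: eq_bigr => j _.
by rewrite -{2}XT -trmx_expr mxE expr2.
Qed.

Lemma vnorm2_mulmx_expr_le X v p : X^T = X -> vnorm2 v = 1 ->
  vnorm2 (X *m v) ^+ p.*2 <= \tr (X ^+ p.*2).
Proof.
move=> XT v1; pose a k := \sum_i (X ^+ k *m v) i 0 ^+ 2.
have expr_mulmxS k : X ^+ k.+1 *m v = X *m (X ^+ k *m v) by rewrite exprS mulmxA.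
have sum_v : \sum_i v i 0 ^+ 2 = 1 by rewrite -sqr_vnorm2 v1 expr1n.
have a_logconvex k : a k.+1 ^+ 2 <= a k * a k.+2.
  suff -> : a k.+1 = \sum_i (X ^+ k *m v) i 0 * (X ^+ k.+2 *m v) i 0.
    exact: sum_CauchySchwarz.
  by rewrite !expr_mulmxS -sum_mulmx_sym // -expr_mulmxS.
have -> : vnorm2 (X *m v) ^+ p.*2 = a 1 ^+ p.
  by rewrite -mul2n exprM sqr_vnorm2.
apply: le_trans (logconvex_expr_le p _ _ a_logconvex) _ => [k||].
- by apply: sumr_ge0 => i _; exact: sqr_ge0.
- by rewrite /a expr0 mul1mx.
rewrite mxtrace_expr_double //; apply: ler_sum => i _; rewrite mxE.
by apply: le_trans (sum_CauchySchwarz _ _) _; rewrite sum_v mulr1.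
Qed.

Lemma opnorm_ge0 A : 0 <= opnorm A.
Proof.
rewrite /opnorm; set S := (X in sup X).
have [->|/set0P[x Sx]] := eqVneq S set0; first by rewrite sup0.
have [ubS|nubS] := pselect (has_ubound S); last by rewrite sup_out // => -[_ /nubS].
apply: (@le_trans _ _ x); last exact: ub_le_sup.
by case: Sx => v _ <-; exact: sqrtr_ge0.
Qed.

Lemma opnorm_expr_le_trace X p : (0 < p)%N -> X^T = X ->
  opnorm X ^+ p.*2 <= \tr (X ^+ p.*2).
Proof.
move=> p_gt0 XT; have p2_gt0 : (0 < p.*2)%N by rewrite double_gt0.
have tr_ge0 : 0 <= \tr (X ^+ p.*2).
  rewrite mxtrace_expr_double //.
  by do 2 (apply: sumr_ge0 => ? _); exact: sqr_ge0.
pose r := \tr (X ^+ p.*2) `^ p.*2%:R^-1.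
have rE : r ^+ p.*2 = \tr (X ^+ p.*2).
  by rewrite -powR_mulrn ?powR_ge0 // -powRrM mulVf ?powRr1 // pnatr_eq0 -lt0n.
rewrite -rE lerXn2r ?nnegrE ?opnorm_ge0 ?powR_ge0 //.
rewrite /opnorm; set S := (Y in sup Y).
have [->|/set0P S_neq0] := eqVneq S set0; first by rewrite sup0 powR_ge0.
apply: ge_sup => // _ [v /= v1 <-].
by rewrite -(ler_pXn2r p2_gt0) ?nnegrE ?sqrtr_ge0 ?powR_ge0 // rE vnorm2_mulmx_expr_le.
Qed.

End opnorm_trace.

(** * Integrals and independence *)

Lemma ge0_le_integral_nonmeasurable d (T : measurableType d) (R : realType)
    (mu : {measure set T -> \bar R}) (f h : T -> \bar R) :
  (forall x, 0 <= f x)%E -> (forall x, f x <= h x)%E ->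
  (\int[mu]_x f x <= \int[mu]_x h x)%E.
Proof.
move=> f_ge0 fh; have h_ge0 x : (0 <= h x)%E by apply: le_trans (fh x).
rewrite !ge0_integralTE //; apply: ge_ereal_sup => _ [s /= sf <-].
by apply: ereal_sup_ubound; exists s => // x; apply: le_trans (fh x).
Qed.

Section has_integral.
Context d (T : measurableType d) (R : realType) (mu : {measure set T -> \bar R}).
Implicit Types (f h : T -> R) (a c : R).

Definition has_integral f c : Prop :=
  mu.-integrable setT (EFin \o f) /\ (\int[mu]_x (f x)%:E = c%:E)%E.

Lemma integrable_has_integral f :
  mu.-integrable setT (EFin \o f) -> has_integral f (\int[mu]_x f x).
Proof. by move=> fi; split; rewrite // fineK // integrable_fin_num. Qed.

Lemma has_integral_Rintegral f c : has_integral f c -> \int[mu]_x f x = c.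
Proof. by case=> _; rewrite /Rintegral => ->. Qed.

Lemma ge0_has_integral f c : measurable_fun setT f -> (forall x, 0 <= f x) ->
  (\int[mu]_x (f x)%:E = c%:E)%E -> has_integral f c.
Proof.
move=> mf f_ge0 fc; split=> //; apply/integrableP; split; first exact/measurable_EFinP.
by under eq_integral do rewrite /= ger0_norm //; rewrite fc ltry.
Qed.

Lemma has_integralZ f c a : has_integral f c -> has_integral (fun x => a * f x) (a * c).
Proof.
case=> fi fc; split; first exact: (integrableZl measurableT a fi).
by rewrite (integralZl measurableT fi) fc.
Qed.

Lemma has_integralD f h c a : has_integral f c -> has_integral h a ->
  has_integral (fun x => f x + h x) (c + a).
Proof.
case=> fi fc [hi ha]; split; first exact: (integrableD measurableT fi hi).
by rewrite (integralD measurableT fi hi) fc ha.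
Qed.

Lemma has_integralB f h c a : has_integral f c -> has_integral h a ->
  has_integral (fun x => f x - h x) (c - a).
Proof.
case=> fi fc [hi ha]; split; first exact: (integrableB measurableT fi hi).
by rewrite (integralB measurableT fi hi) fc ha.
Qed.

Lemma has_integral_sum (I : finType) (F : I -> T -> R) (c : I -> R) :
  (forall i, has_integral (F i) (c i)) ->
  has_integral (fun x => \sum_i F i x) (\sum_i c i).
Proof.
move=> Fc; have Fi i := (Fc i).1; split.
  have := integrable_sum measurableT (index_enum I) (fun i (_ : true) => Fi i).
  by apply: eq_integrable => // x _; rewrite sumEFin.
under eq_integral do rewrite -sumEFin.
by rewrite integral_sum // -sumEFin; apply: eq_bigr => i _; rewrite (Fc i).2.
Qed.

End has_integral.

Lemma has_integral_cst d (T : measurableType d) (R : realType) (P : probability T R)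
  (c : R) : has_integral P (fun=> c) c.
Proof.
split; first exact: finite_measure_integrable_cst.
by rewrite integral_cst //= probability_setT mule1.
Qed.

Lemma measurable_preimage d1 d2 (T : measurableType d1) (U : measurableType d2)
    (X : T -> U) (A : set U) :
  measurable_fun setT X -> measurable A -> measurable (X @^-1` A).
Proof. by move=> mX mA; rewrite -[X in measurable X]setTI; exact: mX. Qed.

Lemma integral_indic_comp d1 d2 (T : measurableType d1) (U : measurableType d2)
    (R : realType) (mu : {measure set T -> \bar R}) (X : T -> U) (A : set U) :
  measurable_fun setT X -> measurable A ->
  (\int[mu]_w (\1_A (X w))%:E = mu (X @^-1` A))%E.
Proof.
move=> mX mA; have := integral_indic mu measurableT (measurable_preimage mX mA).
by rewrite setIT.
Qed.

Section ge0_integral_comp.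
Context d1 d2 (T : measurableType d1) (U : measurableType d2) (R : realType).
Variables (mu : {measure set T -> \bar R}) (X : T -> U) (Y : T -> R).
Hypotheses (mX : measurable_fun setT X) (mY : measurable_fun setT Y).
Hypothesis Y_ge0 : forall w, 0 <= Y w.
Import HBNNSimple.

Lemma ge0_integral_nnsfun_comp (h : {nnsfun U >-> R}) :
  (\int[mu]_w (Y w * h (X w))%:E =
   \sum_(y \in range h) y%:E * \int[mu]_w (Y w * \1_(h @^-1` [set y]) (X w))%:E)%E.
Proof.
have mI y : measurable_fun setT (fun w => \1_(h @^-1` [set y]) (X w) : R).
  by apply: measurableT_comp.
transitivity (\int[mu]_w \sum_(y \in range h)
    (Y w * (y * \1_(h @^-1` [set y]) (X w)))%:E)%E.
  apply: eq_integral => w _.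
  by rewrite fsumEFin // [in LHS]fimfunE mulr_fsumr.
rewrite ge0_integral_fsum //; last 2 first.
- by move=> y; apply/measurable_EFinP; do 2 apply: measurable_funM => //.
- move=> y w _; rewrite lee_fin mulr_ge0 //.
  by have := nnfun_muleindic_ge0 h y (X w); rewrite lee_fin.
apply: eq_fsbigr => y /[!inE] -[x _ <-].
under eq_integral do rewrite mulrCA EFinM.
rewrite ge0_integralZl // ?lee_fin //.
- by apply/measurable_EFinP/measurable_funM.
- by move=> w _; rewrite lee_fin mulr_ge0.
Qed.

Lemma ge0_integral_comp_lim (f : U -> R) (mf : measurable_fun setT (EFin \o f)) :
  (forall x, 0 <= f x) ->
  (\int[mu]_w (Y w * f (X w))%:E =
   limn (fun k => \int[mu]_w (Y w * nnsfun_approx measurableT mf k (X w))%:E))%E.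
Proof.
move=> f_ge0; set h := nnsfun_approx _ _.
rewrite -monotone_convergence //.
- apply: eq_integral => w _; apply/esym/cvg_lim => //.
  under eq_fun do rewrite EFinM.
  rewrite EFinM; apply: cvgeZl => //.
  by apply: cvg_nnsfun_approx => // x _; rewrite lee_fin.
- move=> k; apply/measurable_EFinP/measurable_funM => //.
  exact: measurableT_comp.
- by move=> k w _; rewrite lee_fin mulr_ge0.
- move=> w _ j k jk; rewrite lee_fin ler_wpM2l //.
  exact/lefP/nd_nnsfun_approx.
Qed.

End ge0_integral_comp.

Section eq_ge0_integral_comp.
Context d1 d2 d3 (T : measurableType d1) (T' : measurableType d2)
  (U : measurableType d3) (R : realType).
Variables (mu : {measure set T -> \bar R}) (mu' : {measure set T' -> \bar R}).
Variables (X : T -> U) (X' : T' -> U) (Y : T -> R) (Y' : T' -> R).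
Hypotheses (mX : measurable_fun setT X) (mX' : measurable_fun setT X').
Hypotheses (mY : measurable_fun setT Y) (mY' : measurable_fun setT Y').
Hypotheses (Y_ge0 : forall w, 0 <= Y w) (Y'_ge0 : forall w, 0 <= Y' w).
Import HBNNSimple.

Lemma eq_ge0_integral_comp (f : U -> R) :
  (forall A, measurable A ->
     \int[mu]_w (Y w * \1_A (X w))%:E = \int[mu']_w (Y' w * \1_A (X' w))%:E)%E ->
  measurable_fun setT f -> (forall x, 0 <= f x) ->
  (\int[mu]_w (Y w * f (X w))%:E = \int[mu']_w (Y' w * f (X' w))%:E)%E.
Proof.
move=> eqA /measurable_EFinP mf f_ge0.
rewrite (ge0_integral_comp_lim mu mX mY Y_ge0 mf) //.
rewrite (ge0_integral_comp_lim mu' mX' mY' Y'_ge0 mf) //.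
congr (limn _); apply/funext => k.
rewrite !ge0_integral_nnsfun_comp //; apply: eq_fsbigr => y _.
by congr (_ * _)%E; exact: eqA.
Qed.

End eq_ge0_integral_comp.

Section independence.
Context d (T : measurableType d) (R : realType) (I : finType).
Variables (P : probability T R) (X : I -> T -> R).
Implicit Types (f : I -> R -> R) (h : R -> R) (i : I).

Definition mutually_independent : Prop :=
  forall A : I -> set R, (forall i, measurable (A i)) ->
    P [set w | forall i, A i (X i w)] = (\prod_i P (X i @^-1` A i))%E.

Definition mean_factorizes f : Prop :=
  has_integral P (fun w => \prod_i f i (X i w)) (\prod_i \int[P]_w f i (X i w)).

Hypothesis mX : forall i, measurable_fun setT (X i).
Hypothesis indepX : mutually_independent.

Let measurable_prod_comp f (J : {pred I}) : (forall i, measurable_fun setT (f i)) ->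
  measurable_fun setT (fun w => \prod_(i | J i) f i (X i w)).
Proof.
move=> mf; under eq_fun do rewrite -big_filter.
by apply: measurable_prod => i _; exact: measurableT_comp.
Qed.

Let prod_comp_dfwith f i h w :
  \prod_j dfwith f i h j (X j w) = h (X i w) * \prod_(j | j != i) f j (X j w).
Proof. exact: (big_dfwith _ (fun j h => h (X j w))). Qed.

Let prod_mean_dfwith f i h : \prod_j \int[P]_w dfwith f i h j (X j w) =
  \int[P]_w h (X i w) * \prod_(j | j != i) \int[P]_w f j (X j w).
Proof. exact: (big_dfwith _ (fun j h => \int[P]_w h (X j w))). Qed.

Lemma mean_factorizes_indic f :
  (forall i, exists A, measurable A /\ f i = \1_A) -> mean_factorizes f.
Proof.
move=> /choice[A fA]; have mA i : measurable (A i) by have [] := fA i.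
have fE i : f i = \1_(A i) by have [] := fA i.
pose E := [set w | forall i, A i (X i w)].
have prodE w : \prod_i f i (X i w) = \1_E w.
  have [Ew|nEw] := pselect (E w).
    rewrite indicE mem_set // big1 // => i _.
    by rewrite fE indicE mem_set //; exact: Ew.
  have [i nAi] : exists i, ~ A i (X i w) by exact/existsNP.
  by rewrite indicE memNset // (bigD1 i) //= fE indicE memNset // mul0r.
have mE : measurable E.
  rewrite (_ : E = \bigcap_(i in setT) (X i @^-1` A i)).
    by apply: fin_bigcap_measurable => // i _; exact: measurable_preimage.
  by apply/seteqP; split => w Ew i *; exact: Ew.
apply: ge0_has_integral => [|w|].
- by apply: measurable_prod_comp => i; rewrite fE; exact: measurable_indic.
- by rewrite prodE.
under eq_integral do rewrite prodE.
rewrite integral_indic // setIT; apply: (etrans (indepX mA)).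
rewrite -prodEFin; apply: eq_bigr => i _.
rewrite /Rintegral fE integral_indic_comp // fineK // fin_num_measure //.
exact: measurable_preimage.
Qed.

(* Indicators are replaced by nonnegative functions one factor at a time, the product
   of the other factors acting as a weight in [eq_ge0_integral_comp]. *)
Lemma mean_factorizes_ge0 f :
  (forall i, [/\ measurable_fun setT (f i), forall x, 0 <= f i x &
                P.-integrable setT (EFin \o (f i \o X i))]) ->
  mean_factorizes f.
Proof.
pose ge0_mean_fun i h := [/\ measurable_fun setT h, forall x, 0 <= h x &
  P.-integrable setT (EFin \o (h \o X i))].
apply: (dfwith_ind (A := fun i h => exists A, measurable A /\ h = \1_A)
                   (B := ge0_mean_fun)) => [i _ [A [mA ->]]||{}f i f_ok].
- split=> //; apply: integrable_indic => //.
  exact: measurable_preimage.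
- exact: mean_factorizes_indic.
have [mfi fi_ge0 ifi] := f_ok i; have mf j : measurable_fun setT (f j) by case: (f_ok j).
have f_ge0 j x : 0 <= f j x by case: (f_ok j).
set Y := fun w => \prod_(j | j != i) f j (X j w).
set c := \prod_(j | j != i) \int[P]_w f j (X j w).
have c_ge0 : 0 <= c by apply: prodr_ge0 => j _; apply: Rintegral_ge0 => w _.
move=> factorizes_indic.
apply: ge0_has_integral => [|w|]; first exact: measurable_prod_comp.
  by apply: prodr_ge0.
rewrite (bigD1 i) //= mulrC EFinM -/c.
under eq_integral do rewrite (bigD1 i) //= mulrC.
transitivity (\int[P]_w (c * f i (X i w))%:E)%E; last first.
  by have [_ ->] := has_integralZ c (integrable_has_integral ifi).
apply: (eq_ge0_integral_comp (X := X i) (X' := X i)) => //.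
- exact: measurable_prod_comp.
- by move=> w; apply: prodr_ge0.
move=> A mA.
have [_] := factorizes_indic \1_A (ex_intro _ A (conj mA erefl)).
rewrite prod_mean_dfwith mulrC.
under eq_integral do rewrite prod_comp_dfwith mulrC.
move=> ->; have i1A : P.-integrable setT (EFin \o (\1_A \o X i)).
  by apply: integrable_indic; exact: measurable_preimage.
by have [_ ->] := has_integralZ c (integrable_has_integral i1A).
Qed.

Lemma has_integral_prod f (c : I -> R) :
  (forall i, measurable_fun setT (f i)) ->
  (forall i, has_integral P (fun w => f i (X i w)) (c i)) ->
  has_integral P (fun w => \prod_i f i (X i w)) (\prod_i c i).
Proof.
move=> mf fc; have -> : \prod_i c i = \prod_i \int[P]_w f i (X i w).
  by apply: eq_bigr => i _; rewrite (has_integral_Rintegral (fc i)).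
pose mean_fun i h := measurable_fun setT h /\ P.-integrable setT (EFin \o (h \o X i)).
have mean_f i : mean_fun i (f i) by split; [exact: mf|exact: (fc i).1].
apply: (dfwith_ind (Q := mean_factorizes) (B := mean_fun)
  (A := fun i h => mean_fun i h /\ forall x, 0 <= h x)) mean_f => {fc mf}{}f.
- by move=> h [].
- move=> f_ok; apply: mean_factorizes_ge0 => i.
  by have [[]] := f_ok i.
move=> i f_ok factorizes_ge0; have [mfi ifi] := f_ok i.
have ipos := integrable_funrpos measurableT ifi.
have ineg := integrable_funrneg measurableT ifi.
have fE x : (f i)^\+ x - (f i)^\- x = f i x.
  by rewrite -[in RHS](funrposBneg (f i)).
have := has_integralB
  (factorizes_ge0 _ (conj (conj (measurable_funrpos mfi) ipos) (funrpos_ge0 _)))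
  (factorizes_ge0 _ (conj (conj (measurable_funrneg mfi) ineg) (funrneg_ge0 _))).
rewrite !prod_mean_dfwith -mulrBl -(RintegralB measurableT ipos ineg).
rewrite /mean_factorizes [X in _ -> has_integral _ _ X](bigD1 i) //=.
under [in X in _ -> X]eq_fun do rewrite (bigD1 i) //= -fE.
by under eq_fun do rewrite !prod_comp_dfwith -mulrBl; under eq_Rintegral do rewrite fE.
Qed.

End independence.

Section has_integral_density.
Context d1 d2 (T : measurableType d1) (U : measurableType d2) (R : realType).
Variables (mu : {measure set T -> \bar R}) (nu : {measure set U -> \bar R}).
Variables (X : T -> U) (p : U -> R).
Hypotheses (mX : measurable_fun setT X) (mp : measurable_fun setT p).
Hypothesis p_ge0 : forall x, 0 <= p x.
Hypothesis lawX : forall A, measurable A ->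
  mu (X @^-1` A) = (\int[nu]_(x in A) (p x)%:E)%E.

Lemma ge0_integral_density (f : U -> R) :
  measurable_fun setT f -> (forall x, 0 <= f x) ->
  (\int[mu]_w (f (X w))%:E = \int[nu]_x (f x * p x)%:E)%E.
Proof.
move=> mf f_ge0.
under [RHS]eq_integral do rewrite mulrC.
transitivity (\int[mu]_w (1 * f (X w))%:E)%E.
  by under [RHS]eq_integral do rewrite mul1r.
apply: (eq_ge0_integral_comp (Y := fun=> 1) (X' := id)) => // A mA.
under eq_integral do rewrite mul1r.
rewrite integral_indic_comp // lawX // integral_mkcond; apply: eq_integral => x _.
by rewrite patchE indicE; case: ifP => _; rewrite ?mulr1 ?mulr0.
Qed.

Lemma integral_density (f : U -> R) : measurable_fun setT f ->
  (\int[mu]_w (f (X w))%:E = \int[nu]_x (f x * p x)%:E)%E.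
Proof.
move=> mf; have eq_pos (h : U -> R) : measurable_fun setT h ->
    (\int[mu]_w maxe (h (X w))%:E 0 = \int[nu]_x maxe (h x * p x)%:E 0)%E.
  move=> mh; transitivity (\int[mu]_w (h^\+ (X w))%:E)%E.
    by apply: eq_integral => w _; rewrite -EFin_max.
  rewrite ge0_integral_density; [|exact: measurable_funrpos|exact: funrpos_ge0].
  by apply: eq_integral => x _; rewrite -EFin_max -(mul0r (p x)) -maxr_pMl.
rewrite integralE [RHS]integralE; congr (_ - _)%E.
  under eq_integral do rewrite funeposE.
  under [RHS]eq_integral do rewrite funeposE.
  exact: eq_pos.
under eq_integral do rewrite funenegE -EFinN.
under [RHS]eq_integral do rewrite funenegE -EFinN -mulNr.
by apply: (eq_pos (fun x => - f x)); exact: measurableT_comp.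
Qed.

Lemma has_integral_density (f : U -> R) (c : R) : measurable_fun setT f ->
  has_integral nu (fun x => f x * p x) c -> has_integral mu (fun w => f (X w)) c.
Proof.
move=> mf [fpi fpc]; split; last by rewrite integral_density.
apply/integrableP; split; first by apply/measurable_EFinP; exact: measurableT_comp.
rewrite (ge0_integral_density (f := fun x => `|f x|)) //; last exact: measurableT_comp.
case/integrableP: fpi => _; congr (_ < _)%E.
by apply: eq_integral => x _; rewrite /= normrM (ger0_norm (p_ge0 x)).
Qed.

End has_integral_density.

Section integral_derivative.
Variables (R : realType).
Local Notation mu := (@lebesgue_measure R).

Lemma cvg_integral_itv_setT (f : R -> R) : mu.-integrable setT (EFin \o f) ->
  (\int[mu]_(x in `[(- k.+1%:R)%R, k.+1%:R%R]) (f x)%:E)%E @[k --> \oo]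
    --> (\int[mu]_x (f x)%:E)%E.
Proof.
move=> fi; pose A k := `[- k.+1%:R, k.+1%:R]%classic : set R.
under eq_fun do rewrite integral_mkcond.
apply: (@dominated_cvg _ _ _ mu setT measurableT
  (fun k => (EFin \o f) \_ (A k)) _ (abse \o (EFin \o f))) => //.
- move=> k; apply/(measurable_restrictT _ _).1; first exact: measurable_itv.
  by apply: measurable_funTS; case/integrableP: fi.
- move=> x _; apply: cvg_near_cst; near=> k.
  rewrite patchE mem_set // /A /= in_itv /= -ler_norml.
  apply: (@le_trans _ _ k%:R); last by rewrite ler_nat.
  by near: k; exact: nbhs_infty_ger.
- exact: integrable_abse.
- by move=> k x _; rewrite patchE; case: ifP => _ //=; rewrite normr0 lee_fin.
Unshelve. all: by end_near. Qed.

Lemma integral_derivative (f F : R -> R) (l l' : R) :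
  continuous f -> (forall x, is_derive x (1 : R) F (f x)) ->
  mu.-integrable setT (EFin \o f) ->
  F x @[x --> +oo] --> l -> F x @[x --> -oo] --> l' ->
  (\int[mu]_x (f x)%:E = (l - l')%:E)%E.
Proof.
move=> cf dF fi Fl Fl'; have := cvg_integral_itv_setT fi.
have cF : continuous F.
  move=> x; apply/differentiable_continuous/derivable1_diffP.
  by case: (dF x).
have FTC k : (\int[mu]_(x in `[(- k.+1%:R)%R, k.+1%:R%R]) (f x)%:E =
    (F k.+1%:R - F (- k.+1%:R))%:E)%E.
  rewrite EFinB; apply: continuous_FTC2.
  - by rewrite gtrN.
  - exact: continuous_subspaceT.
  - split=> [x _||]; first by case: (dF x).
      by apply: cvg_at_right_filter; exact: cF.
    by apply: cvg_at_left_filter; exact: cF.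
  - by move=> x _; rewrite derive1E; case: (dF x).
under eq_fun do rewrite FTC.
move=> /cvg_unique; apply => //.
have cvg_succ : (k.+1%:R : R) @[k --> \oo] --> +oo.
  by have := @cvgr_idn R; rewrite -cvg_shiftS.
apply: cvg_EFin; first exact: nearW.
apply: cvgB; first by have /cvg_pinftyP := Fl; exact.
by have /cvgNy_compNP/cvg_pinftyP := Fl'; exact.
Qed.

End integral_derivative.

(** * Gaussian integrals of polynomials *)

Lemma cvg_norm_subr_pinfty (R : realType) (m : R) : `|x - m| @[x --> +oo] --> +oo.
Proof.
apply: (ger_cvgy _ (@cvg_addrr _ (- m))); near=> x; exact: ler_norm.
Unshelve. all: by end_near. Qed.

Lemma cvg_norm_subr_ninfty (R : realType) (m : R) : `|x - m| @[x --> -oo] --> +oo.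
Proof.
apply/cvgNy_compNP; rewrite (_ : _ \o _ = fun x => `|x - - m|).
  exact: cvg_norm_subr_pinfty.
by apply/funext => x /=; rewrite -opprD normrN opprK.
Qed.

Section normal_pdf.
Variables (R : realType).
Implicit Types (m s x a : R) (q : {poly R}).
Local Notation mu := (@lebesgue_measure R).

Lemma horner_le_expR q a : 0 < a ->
  exists2 C, 0 <= C & forall x, `|q.[x]| <= C * expR (a * x ^+ 2).
Proof.
elim/poly_ind: q a => [|q c IHq] a a_gt0.
  by exists 0 => // x; rewrite horner0 normr0 mul0r.
have a2_gt0 : 0 < a / 2 by rewrite divr_gt0.
have [C C_ge0 qC] := IHq _ a2_gt0.
pose K := 1 + (a / 2)^-1.
have K_ge0 : 0 <= K by rewrite addr_ge0 // invr_ge0 ltW.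
have norm_le x : `|x| <= K * expR (a / 2 * x ^+ 2).
  apply: (@le_trans _ _ (K * (1 + a / 2 * x ^+ 2))).
    have -> : K * (1 + a / 2 * x ^+ 2) = 1 + (a / 2)^-1 + a / 2 * x ^+ 2 + x ^+ 2.
      by rewrite /K; field; rewrite gt_eqF.
    have := sqr_ge0 (`|x| - 1); rewrite sqrrB real_normK ?num_real //.
    have a2V_ge0 : 0 <= (a / 2)^-1 by rewrite invr_ge0 ltW.
    have := mulr_ge0 (ltW a2_gt0) (sqr_ge0 x); have := sqr_ge0 x.
    by lra.
  by rewrite ler_wpM2l // expR_ge1Dx.
exists (C * K + `|c|) => [|x]; first by rewrite addr_ge0 // mulr_ge0.
rewrite hornerMXaddC (le_trans (ler_normD _ _)) // mulrDl lerD //.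
  have -> : a * x ^+ 2 = a / 2 * x ^+ 2 + a / 2 * x ^+ 2 by field.
  by rewrite normrM expRD mulrACA ler_pM.
by rewrite ler_peMr // -expR0 ler_expR mulr_ge0 ?sqr_ge0 // ltW.
Qed.

Lemma horner_normal_pdf_le m s q : s != 0 ->
  exists2 C, 0 <= C & forall x, `|q.[x] * normal_pdf m s x| <= C * normal_pdf m (2 * s) x.
Proof.
move=> s_neq0; have s2_neq0 : 2 * s != 0 by rewrite mulf_neq0 ?pnatr_eq0.
have s2_gt0 : 0 < s ^+ 2 by rewrite exprn_even_gt0.
have a_gt0 : 0 < 3 / (8 * s ^+ 2) by rewrite divr_gt0 // mulr_gt0.
have [C C_ge0 qC] := horner_le_expR (q \Po ('X + m%:P)) a_gt0.
exists (C * normal_peak s / normal_peak (2 * s)) => [|x].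
  by rewrite divr_ge0 ?mulr_ge0 ?normal_peak_ge0.
have peak2_neq0 : normal_peak (2 * s) != 0 by rewrite gt_eqF // normal_peak_gt0.
rewrite normrM (ger0_norm (normal_pdf_ge0 _ _ _)) !normal_pdfE // [leRHS]mulrA divfK //.
rewrite mulrCA -[leRHS]mulrA [leRHS]mulrCA ler_wpM2l ?normal_peak_ge0 //.
have := qC (x - m); rewrite horner_comp hornerD hornerX hornerC subrK => qx.
apply: le_trans (ler_wpM2r (expR_ge0 _) qx) _.
rewrite -mulrA -expRD ler_wpM2l //.
rewrite [X in expR X](_ : _ = - (x - m) ^+ 2 / ((2 * s) ^+ 2 *+ 2)) //.
by rewrite -[s ^+ 2 *+ 2]mulr_natr -[(2 * s) ^+ 2 *+ 2]mulr_natr; field.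
Qed.

Lemma continuous_horner_normal_pdf m s q : s != 0 ->
  continuous (fun x => q.[x] * normal_pdf m s x).
Proof.
move=> s_neq0 x; apply: cvgM; first exact: continuous_horner.
exact: continuous_normal_pdf.
Qed.

Lemma integrable_horner_normal_pdf m s q : s != 0 ->
  mu.-integrable setT (EFin \o (fun x => q.[x] * normal_pdf m s x)).
Proof.
move=> s_neq0; have [C C_ge0 qC] := horner_normal_pdf_le m q s_neq0.
have iC := integrableZl measurableT C (integrable_normal_pdf m (2 * s)).
apply: (le_integrable measurableT _ _ iC) => [|x _ /=].
  apply/measurable_EFinP/measurable_funM; first exact: measurable_poly.
  exact: measurable_normal_pdf.
by rewrite lee_fin (le_trans (qC x)) // ler_norm.
Qed.

Lemma cvg_horner_normal_pdf m s q (F : set_system R) {FF : Filter F} : s != 0 ->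
  `|x - m| @[x --> F] --> +oo -> q.[x] * normal_pdf m s x @[x --> F] --> 0.
Proof.
move=> s_neq0 Fy; have s2_neq0 : 2 * s != 0 by rewrite mulf_neq0 ?pnatr_eq0.
have [C C_ge0 qC] := horner_normal_pdf_le m (('X - m%:P) * q) s_neq0.
apply/cvgr0Pnorm_le => e e_gt0; near=> x.
have x_gt0 : 0 < `|x - m| by near: x; exact: (cvgry_gt Fy).
rewrite -(ler_pM2l x_gt0) -normrM mulrA.
have := qC x; rewrite !hornerE => /le_trans; apply.
apply: (@le_trans _ _ (C * normal_peak (2 * s))).
  by rewrite ler_wpM2l // normal_pdf_ub.
rewrite -ler_pdivrMr //; near: x; exact: (cvgry_ge Fy).
Unshelve. all: by end_near. Qed.

Lemma is_derive_normal_pdf m s x : s != 0 ->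
  is_derive x 1 (normal_pdf m s) (- (x - m) / s ^+ 2 * normal_pdf m s x).
Proof.
move=> s_neq0; rewrite normal_pdfE //.
rewrite (_ : (fun y => _) = fun y =>
    normal_peak s *: expR (- ((s ^+ 2 *+ 2)^-1 *: ((y - m) ^+ 2 : R^o)))); last first.
  by apply/funext => y; rewrite /normal_fun /GRing.scale /= mulNr [_ / _]mulrC.
apply: is_derive_eq; rewrite /GRing.scale /= /normal_fun.
rewrite [- _ ^+ 2 / _]mulNr [_ ^+ 2 / _]mulrC -[s ^+ 2 *+ 2]mulr_natr.
by move: (expR _) => y; field.
Qed.

Lemma has_integral_Stein m s q : s != 0 ->
  has_integral mu
    (fun x => (('X - m%:P) * q - s ^+ 2 *: q^`()).[x] * normal_pdf m s x) 0.
Proof.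
move=> s_neq0; set r := _ - _.
have ir := integrable_horner_normal_pdf m r s_neq0; split=> //.
pose F x := (- s ^+ 2 *: q).[x] * normal_pdf m s x.
rewrite (_ : 0%:E = (0 - 0)%:E); last by rewrite subr0.
apply: (integral_derivative (F := F)) => //.
- exact: continuous_horner_normal_pdf.
- move=> x.
  have dpdf := is_derive_normal_pdf m x s_neq0.
  apply: (is_derive_eq (is_deriveM (is_derive_poly _ x) dpdf)).
  by rewrite /r derivZ !hornerE /GRing.scale /=; field.
- by apply: cvg_horner_normal_pdf => //; exact: cvg_norm_subr_pinfty.
- by apply: cvg_horner_normal_pdf => //; exact: cvg_norm_subr_ninfty.
Qed.

End normal_pdf.

(** * Hermite polynomials and Wick products *)

Section hermite.
Variable R : realType.

Fixpoint hermite (k : nat) : {poly R} :=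
  if k is k'.+1 then 'X * hermite k' - (hermite k')^`() else 1.

Lemma deriv_hermite (k : nat) : (hermite k)^`() = k%:R *: hermite k.-1.
Proof.
elim: k => [|k IHk]; first by rewrite /= scale0r derivC.
rewrite /= derivB derivM derivX mul1r IHk derivZ -natr1 scalerDl scale1r.
rewrite -addrA [RHS]addrC; congr (_ + _).
case: k IHk => [|k] _; first by rewrite !scale0r mulr0 subrr.
by rewrite /= -scalerAr -scalerBr.
Qed.

Lemma mulX_hermite (k : nat) : 'X * hermite k = hermite k.+1 + k%:R *: hermite k.-1.
Proof. by rewrite /= deriv_hermite subrK. Qed.

Lemma has_integral_hermite d (T : measurableType d) (P : probability T R) (X : T -> R)
    (k : nat) :
  measurable_fun setT X ->
  (forall A, measurable A -> P (X @^-1` A) = normal_prob 0 1 A) ->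
  has_integral P (fun w => (hermite k).[X w]) (k == 0%N)%:R.
Proof.
move=> mX lawX; case: k => [|k].
  by under eq_fun do rewrite hornerC; exact: has_integral_cst.
apply: (has_integral_density (nu := lebesgue_measure) mX (measurable_normal_pdf 0 1)
  (normal_pdf_ge0 0 1) lawX (@measurable_poly _ (hermite k.+1) setT)).
have := has_integral_Stein 0 (hermite k) (oner_neq0 R).
by rewrite subr0 expr1n scale1r.
Qed.

End hermite.

Section wick_product.
Context d (T : measurableType d) (R : realType) (I : finType).
Variables (P : probability T R) (b : I -> R) (xi : I -> T -> R).
Implicit Types (i : I) (m : I -> nat).

Definition std_normal_family : Prop :=
  [/\ forall i, measurable_fun setT (xi i),
      forall i A, measurable A -> P (xi i @^-1` A) = normal_prob 0 1 A &
      mutually_independent P xi].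

Definition wick_product m (w : T) : R :=
  \prod_i (b i ^+ m i * (hermite R (m i)).[xi i w]).

Lemma wick_product0 w : wick_product (fun=> 0%N) w = 1.
Proof. by rewrite /wick_product big1 // => i _; rewrite mul1r hornerC. Qed.

Lemma mul_wick_product i m w : b i * xi i w * wick_product m w =
  wick_product (raise i m) w + (m i)%:R * b i ^+ 2 * wick_product (lower i m) w.
Proof.
pose F j k := b j ^+ k * (hermite R k).[xi j w].
rewrite /wick_product (big_dfwith _ F) (big_dfwith _ F) (bigD1 i) //= -/(F i (m i)).
rewrite [RHS](_ : _ = (F i (m i).+1 + (m i)%:R * b i ^+ 2 * F i (m i).-1) *
  \prod_(j | j != i) F j (m j)); last by ring.
rewrite mulrA; congr (_ * _); rewrite /F.
have := congr1 (horner^~ (xi i w)) (mulX_hermite R (m i)).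
rewrite hornerD hornerZ hornerM hornerX => xiH.
have bS : (m i)%:R * (b i ^+ 2 * b i ^+ (m i).-1) = (m i)%:R * b i ^+ (m i).+1.
  by case: (m i) => [|k]; rewrite ?mul0r // -exprD.
rewrite mulrACA [xi i w * _]xiH -exprS mulrDr; congr (_ + _).
by rewrite mulrCA mulrA -bS !mulrA.
Qed.

Lemma has_integral_wick_product m :
  std_normal_family -> has_integral P (wick_product m) [forall i, m i == 0%N]%:R.
Proof.
case=> mxi law_xi indep_xi.
have -> : [forall i, m i == 0%N]%:R = \prod_i (b i ^+ m i * (m i == 0%N)%:R).
  have [m0|/existsNP[i /negP/negbTE mi]] := forallP.
    by rewrite big1 // => i _; rewrite (eqP (m0 i)) mul1r.
  by rewrite (bigD1 i) //= mi mulr0 mul0r.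
apply: (@has_integral_prod _ _ _ _ _ _ mxi indep_xi
  (fun i x => b i ^+ m i * (hermite R (m i)).[x])) => i.
  by apply: measurable_funM => //; exact: measurable_poly.
by apply: has_integralZ; apply: has_integral_hermite => //; exact: law_xi.
Qed.

End wick_product.

(** * Expected traces *)

Definition edgemx (R : Type) (n : nat) (a : uedge n -> R) : 'M[R]_n :=
  \matrix_(v, w) a (edge v w).

Lemma trmx_edgemx (R : Type) (n : nat) (a : uedge n -> R) : (edgemx a)^T = edgemx a.
Proof. by apply/matrixP => v w; rewrite !mxE edgeC. Qed.

Section expected_trace.
Context d (T : measurableType d) (R : realType) (P : probability T R) (n : nat).
Variables (b : uedge n -> R) (xi : uedge n -> T -> R).
Hypothesis xiN : std_normal_family P xi.
Implicit Types (u v : 'I_n) (m : uedge n -> nat) (w : T).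

Local Notation X w := (edgemx (fun e => b e * xi e w)).
Local Notation B := (fun e => b e ^+ 2).

Lemma has_integral_expr_wick_product t m u v :
  has_integral P (fun w => (X w ^+ t) v u * wick_product b xi m w)
    (walk_moment B u t m v).
Proof.
elim: t m v => [|t IHt] m v.
  rewrite /= -mulnb natrM; under eq_fun do rewrite expr0 mxE.
  exact/has_integralZ/has_integral_wick_product.
pose F x m' w := (X w ^+ t) x u * wick_product b xi m' w.
rewrite (_ : (fun w => _) = fun w => \sum_x (F x (raise (edge v x) m) w +
    (m (edge v x))%:R * B (edge v x) * F x (lower (edge v x) m) w)).
  apply: has_integral_sum => x; apply: has_integralD; first exact: IHt.
  by apply: has_integralZ; exact: IHt.
apply/funext => w; rewrite exprS mxE mulr_suml; apply: eq_bigr => x _.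
rewrite mxE mulrAC [_ * (X w ^+ t) _ _]mulrC mul_wick_product /F.
by rewrite mulrDr [Y in _ + Y = _]mulrCA.
Qed.

Lemma has_integral_trace t : has_integral P (fun w => \tr (X w ^+ t))
  (\sum_u walk_moment B u t (fun=> 0%N) u).
Proof.
apply: has_integral_sum => u.
have := has_integral_expr_wick_product t (fun=> 0%N) u u.
by under eq_fun do rewrite wick_product0 mulr1.
Qed.

Lemma expectation_opnorm_le p (a : R) : (0 < p)%N -> 0 <= a ->
  \sum_u walk_moment B u p.*2 (fun=> 0%N) u <= a ^+ p.*2 ->
  ('E_P[fun w => opnorm (X w)] <= a%:E)%E.
Proof.
move=> p_gt0 a_ge0 Sa; apply/lee_addgt0Pr => e e_gt0; rewrite -EFinD.
have ae_gt0 : 0 < a + e by rewrite ltr_wpDl.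
have Sae : \sum_u walk_moment B u p.*2 (fun=> 0%N) u <= (a + e) ^+ p.*2.
  by apply: le_trans Sa _; rewrite lerXn2r ?nnegrE ?lerDl // ltW.
have p2_gt0 : (0 < p.*2)%N by rewrite double_gt0.
pose k := (a + e) / p.*2%:R; have k_ge0 : 0 <= k by rewrite divr_ge0 // ltW.
have [_ trE] := has_integralD (has_integral_cst P (a + e - k))
  (has_integralZ (k / (a + e) ^+ p.*2) (has_integral_trace p.*2)).
rewrite unlock; apply: (@le_trans _ _ (a + e - k + k / (a + e) ^+ p.*2 *
    \sum_u walk_moment B u p.*2 (fun=> 0%N) u)%:E); last first.
  rewrite lee_fin -addrA gerDl addrC subr_le0 mulrAC ler_pdivrMr ?exprn_gt0 //.
  exact: ler_wpM2l.
rewrite -trE; apply: ge0_le_integral_nonmeasurable => w; rewrite lee_fin ?opnorm_ge0 //.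
apply: le_trans (le_expr_tangent (opnorm_ge0 _) ae_gt0 p2_gt0) _.
rewrite -[leRHS]addrA lerD2l mulrBr mulr1 [leRHS]addrC lerD2r -/k mulrA [leLHS]mulrAC.
rewrite ler_wpM2l ?divr_ge0 ?exprn_ge0 ?(ltW ae_gt0) //.
by rewrite opnorm_expr_le_trace // trmx_edgemx.
Qed.

End expected_trace.

(** * Expected operator norm *)

Section sigma.
Variables (R : realType) (n : nat) (b : 'I_n -> 'I_n -> R).

Lemma sigma_row_ge0 : 0 <= sigma_row b.
Proof. exact: bigmax_ge_id. Qed.

Lemma sigma_star_ge0 : 0 <= sigma_star b.
Proof. exact: bigmax_ge_id. Qed.

Lemma sum_symext_sqr_le v : \sum_w symext b v w ^+ 2 <= sigma_row b ^+ 2.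
Proof.
have sum_ge0 : 0 <= \sum_w symext b v w ^+ 2.
  by apply: sumr_ge0 => w _; exact: sqr_ge0.
rewrite -[leLHS]sqr_sqrtr // lerXn2r ?nnegrE ?sqrtr_ge0 ?sigma_row_ge0 //.
exact: le_bigmax.
Qed.

Lemma symext_sqr_le v w : symext b v w ^+ 2 <= sigma_star b ^+ 2.
Proof.
rewrite -real_normK ?num_real // lerXn2r ?nnegrE ?sigma_star_ge0 //.
by apply: le_trans (le_bigmax _ _ v); exact: le_bigmax.
Qed.

End sigma.

Section expected_opnorm.
Context d (T : measurableType d) (R : realType) (P : probability T R) (n : nat).
Variables (b : 'I_n -> 'I_n -> R) (g : 'I_n -> 'I_n -> T -> R).
Hypothesis gN : iid_std_gaussian P g.

Lemma randmx_edgemx w : randmx b g w = edgemx (fun e => edge_fun b e * edge_fun g e w).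
Proof. by apply/matrixP => i j; rewrite !mxE !symext_edge. Qed.

Lemma prod_uedge (F : 'I_n -> 'I_n -> \bar R) :
  (\prod_(i < n) \prod_(j < n | (j <= i)%N) F i j =
   \prod_e edge_fun F e)%E.
Proof.
rewrite pair_big_dep.
by rewrite (big_sub [pred e : 'I_n * 'I_n | (e.2 <= e.1)%N] (fun e => F e.1 e.2)).
Qed.

Lemma std_normal_family_edge_fun : std_normal_family P (edge_fun g).
Proof.
case: gN => mg lawg indepg; split=> [[[i j] ij]|[[i j] ij]|A mA].
- exact: mg.
- exact: lawg.
rewrite (_ : [set w | _] =
    [set w | forall i j : 'I_n, (j <= i)%N -> A (edge i j) (g i j w)]).
  rewrite (indepg (fun i j => A (edge i j))) // prod_uedge.
  by apply: eq_bigr => e _; rewrite /edge_fun edge_val.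
apply/seteqP; split => w Aw.
  by move=> i j ij; have := Aw (edge i j); rewrite /edge_fun /= ij.
by move=> e; have := Aw _ _ (valP e); rewrite edge_val.
Qed.

Let mulr_natl_sum (x : R) : n%:R * x = \sum_(u < n) x.
Proof. by rewrite sumr_const card_ord mulr_natl. Qed.

Lemma expectation_opnorm_randmx_le p (a : R) : (0 < p)%N -> 0 <= a ->
  \sum_u walk_moment (fun e => edge_fun b e ^+ 2) u p.*2 (fun=> 0%N) u <= a ^+ p.*2 ->
  ('E_P[fun w => opnorm (randmx b g w)] <= a%:E)%E.
Proof.
move=> p_gt0 a_ge0 /(expectation_opnorm_le std_normal_family_edge_fun p_gt0 a_ge0).
by under eq_fun do rewrite -randmx_edgemx.
Qed.

Lemma expectation_opnorm_randmx_le_sqrt :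
  ('E_P[fun w => opnorm (randmx b g w)] <= (Num.sqrt n%:R * sigma_row b)%:E)%E.
Proof.
apply: (expectation_opnorm_randmx_le (p := 1)) => //.
  by rewrite mulr_ge0 ?sqrtr_ge0 ?sigma_row_ge0.
rewrite exprMn sqr_sqrtr // mulr_natl_sum.
apply: ler_sum => u _; rewrite walk_moment2.
by under eq_bigr do rewrite -symext_edge; exact: sum_symext_sqr_le.
Qed.

Lemma sum_closed_walk_moment_le t (c : R) : 0 < c ->
  sigma_row b ^+ 2 + sigma_star b ^+ 2 * t.*2%:R <= c ^+ 2 ->
  \sum_u walk_moment (fun e => edge_fun b e ^+ 2) u t (fun=> 0%N) u <=
    n%:R * (2 * c) ^+ t.
Proof.
move=> c_gt0 c_le; rewrite mulr_natl_sum; apply: ler_sum => u _.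
apply: (@closed_walk_moment_le _ _ _ _ (sigma_star b ^+ 2) (sigma_row b ^+ 2)) => //.
- by move=> e; exact: sqr_ge0.
- by move=> e; rewrite -[e]edge_val -symext_edge; exact: symext_sqr_le.
- by move=> v; under eq_bigr do rewrite -symext_edge; exact: sum_symext_sqr_le.
Qed.

Lemma expectation_opnorm_randmx_le_expr p (rho : R) :
  (0 < p)%N -> 0 < rho -> n%:R <= rho ^+ p.*2 ->
  ('E_P[fun w => opnorm (randmx b g w)] <=
    (rho * (2 * sigma_row b + 4 * Num.sqrt p%:R * sigma_star b))%:E)%E.
Proof.
move=> p_gt0 rho_gt0 n_le; apply/lee_addgt0Pr => e e_gt0; rewrite -EFinD.
have [sigma_ge0 star_ge0] := (sigma_row_ge0 b, sigma_star_ge0 b).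
set y := Num.sqrt p%:R; have y_ge0 : 0 <= y by exact: sqrtr_ge0.
have yE : p%:R = y ^+ 2 by rewrite sqr_sqrtr.
have e'_gt0 : 0 < e / (2 * rho) by rewrite divr_gt0 // mulr_gt0.
pose a := sigma_row b + 2 * y * sigma_star b; pose c := a + e / (2 * rho).
have a_ge0 : 0 <= a by rewrite addr_ge0 // !mulr_ge0.
have c_gt0 : 0 < c by rewrite ltr_wpDl.
rewrite [X in (_ <= X%:E)%E](_ : _ = rho * (2 * c)); last first.
  by rewrite /c /a; field; rewrite gt_eqF.
apply: (expectation_opnorm_randmx_le p_gt0); first by rewrite !mulr_ge0 // ltW.
rewrite exprMn; apply: le_trans (ler_wpM2r _ n_le); last first.
  by rewrite exprn_ge0 // mulr_ge0 // ltW.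
apply: sum_closed_walk_moment_le => //.
apply: (@le_trans _ _ (a ^+ 2)).
  rewrite -subr_ge0 (_ : _ - _ = 4 * (y * sigma_row b * sigma_star b)).
    by rewrite !mulr_ge0.
  by rewrite -!muln2 !natrM yE /a; ring.
by rewrite lerXn2r ?nnegrE ?(ltW c_gt0) // /c lerDl ltW.
Qed.

End expected_opnorm.

Lemma exists_expr_double_ge (R : realType) (rho y : R) : 1 < rho -> rho <= y ->
  exists p, [/\ (0 < p)%N, y <= rho ^+ p.*2 & p%:R <= ln y / ln rho].
Proof.
move=> rho_gt1 rho_le; have rho_gt0 : 0 < rho by lra.
have y_gt0 : 0 < y by lra.
have ln_gt0 : 0 < ln rho by rewrite ln_gt0.
pose x := ln y / ln rho.
have x_ge1 : 1 <= x by rewrite ler_pdivlMr // mul1r ler_ln ?posrE.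
have x_ge0 : 0 <= x by apply: le_trans x_ge1.
have /andP[p_le x_lt] := truncn_itv x_ge0.
have p_gt0 : (0 < Num.truncn x)%N by rewrite truncn_gt0.
exists (Num.truncn x); split=> //.
rewrite -ler_ln ?posrE ?exprn_gt0 // lnXn // -[leRHS]mulr_natl -ler_pdivrMr //.
by apply: ltW (lt_le_trans x_lt _); rewrite ler_nat -addnn -addn1 leq_add2l.
Qed.

Theorem theorem1p1 (R : realType) (d : measure_display) (T : measurableType d)
  (P : probability T R) (n : nat) (hn : (1 <= n)%N)
  (b : 'I_n -> 'I_n -> R) (g : 'I_n -> 'I_n -> T -> R)
  (hg : iid_std_gaussian P g) (eps : R) (heps0 : 0 < eps) (heps1 : eps <= 1 / 2) :
  ('E_P[fun w => opnorm (randmx b g w)] <=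
   ((1 + eps) * (2 * sigma_row b
       + 6 / Num.sqrt (ln (1 + eps)) * sigma_star b * Num.sqrt (ln n%:R)))%:E)%E.
Proof.
have [sigma_ge0 star_ge0] := (sigma_row_ge0 b, sigma_star_ge0 b).
have [n1|n_gt1] := leqP n 1.
  (* Here [ln n = 0] leaves no room for a positive moment order. *)
  apply: le_trans (expectation_opnorm_randmx_le_sqrt b hg) _.
  have -> : n%:R = 1 :> R by rewrite (_ : n = 1%N) //; apply/eqP; rewrite eqn_leq n1.
  by rewrite lee_fin ln1 sqrtr0 sqrtr1; nra.
have rho_gt1 : 1 < 1 + eps by rewrite ltrDl.
have rho_le : 1 + eps <= n%:R.
  by apply: (@le_trans _ _ 2); [lra|rewrite ler_nat].
have [p [p_gt0 n_le p_le]] := exists_expr_double_ge rho_gt1 rho_le.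
have ln_rho_ge0 : 0 <= ln (1 + eps) by rewrite ltW // ln_gt0.
have ln_n_ge0 : 0 <= ln n%:R :> R by rewrite ln_ge0 // ler1n.
have sqrt_le : Num.sqrt p%:R <= Num.sqrt (ln n%:R) / Num.sqrt (ln (1 + eps)).
  by rewrite -sqrtrV // -sqrtrM // ler_wsqrtr.
apply: le_trans (expectation_opnorm_randmx_le_expr b hg p_gt0 _ n_le) _; first by lra.
rewrite lee_fin ler_pM2l ?addr_gt0 // lerD2l.
have -> : 6 / Num.sqrt (ln (1 + eps)) * sigma_star b * Num.sqrt (ln n%:R) =
  6 * (Num.sqrt (ln n%:R) / Num.sqrt (ln (1 + eps))) * sigma_star b by ring.
by rewrite ler_wpM2r // ler_pM // ler_nat.
Qed.
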